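(* As formal power series in $t$, with $x=\cos\theta$, $$(abct)_\infty\sum_{k=0}^\infty\frac{p_k(x;a,b,c,0|q)}{(q,abct)_k}\,t^k=\frac{(at,bt,ct)_\infty}{(te^{i\theta},te^{-i\theta})_\infty}.$$
   Context: $q$ is a complex number with $0<|q|<1$, and $a,b,c$ are complex parameters. Notation: $(z)_n=\prod_{i=0}^{n-1}(1-zq^i)$, $(z)_\infty=\prod_{i\ge0}(1-zq^i)$, $(z_1,\dots,z_k)_n=(z_1)_n\cdots(z_k)_n$ for $n$ finite or $\infty$. The Askey-Wilson polynomials are, with $x=\cos\theta$, $$p_n(x;a,b,c,d|q)=\frac{(ab,ac,ad)_n}{a^n}\sum_{k=0}^n\frac{(q^{-n},abcdq^{n-1},ae^{i\theta},ae^{-i\theta})_k}{(q,ab,ac,ad)_k}q^k ,$$ which is a polynomial in $x$ whose coefficients are polynomial in $a,b,c,d$ (with values at exceptional parameters, such as $a=0$, defined by this polynomial dependence). The polynomials $p_n(x;a,b,c,0|q)$ (with $d=0$) are the continuous dual $q$-Hahn polynomials. *)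

(* Defs.v *)
From HB Require Import structures.
From mathcomp Require Import all_boot all_order all_algebra.
From mathcomp Require Import all_classical all_reals all_analysis.
From mathcomp Require Export complex.
(* The notations of [mpoly] clash with those of MathComp-Analysis. *)
From mathcomp Require Import -(notations) mpoly.

Set Implicit Arguments.
Unset Strict Implicit.
Unset Printing Implicit Defensive.

Import Order.TTheory GRing.Theory Num.Theory.
Import numFieldNormedType.Exports.
Local Open Scope ring_scope.

Record fps (R : Type) := Fps { fps_coef : nat -> R }.

Arguments Fps {R} _.
Arguments fps_coef {R} _ _.

Lemma fpsP (R : Type) (f g : fps R) : fps_coef f =1 fps_coef g <-> f = g.
Proof. by split=> [|-> //]; case: f g => f [g] /= /funext ->. Qed.

HB.instance Definition _ (R : Type) := gen_eqMixin (fps R).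
HB.instance Definition _ (R : Type) := gen_choiceMixin (fps R).

Section FpsRing.
Variable R : comNzRingType.
Implicit Types f g h : fps R.

Definition fpsC (c : R) : fps R := Fps (fun n => if n == 0%N then c else 0).
Definition fpsX : fps R := Fps (fun n => (n == 1%N)%:R).
Definition fps_opp f : fps R := Fps (fun n => - fps_coef f n).
Definition fps_add f g : fps R := Fps (fun n => fps_coef f n + fps_coef g n).
Definition fps_mul f g : fps R :=
  Fps (fun n => \sum_(i < n.+1) fps_coef f i * fps_coef g (n - i)%N).

Fact fps_addA : associative fps_add.
Proof. by move=> f g h; apply/fpsP => n /=; rewrite addrA. Qed.
Fact fps_addC : commutative fps_add.
Proof. by move=> f g; apply/fpsP => n /=; rewrite addrC. Qed.
Fact fps_add0 : left_id (fpsC 0) fps_add.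
Proof. by move=> f; apply/fpsP => n /=; rewrite if_same add0r. Qed.
Fact fps_addN : left_inverse (fpsC 0) fps_opp fps_add.
Proof. by move=> f; apply/fpsP => n /=; rewrite if_same addNr. Qed.

HB.instance Definition _ :=
  GRing.isZmodule.Build (fps R) fps_addA fps_addC fps_add0 fps_addN.

(* The coefficients of a product only depend on truncations of the factors,
   so that the ring axioms reduce to those of [{poly R}]. *)
Let trunc m f : {poly R} := \poly_(i < m) fps_coef f i.

Let trunc_mul m n f g : (n < m)%N ->
  fps_coef (fps_mul f g) n = (trunc m f * trunc m g)`_n.
Proof.
move=> lt_nm; rewrite coefM; apply: eq_bigr => i _; rewrite !coef_poly.
have lein : (i <= n)%N by rewrite -ltnS.
by rewrite (leq_ltn_trans lein lt_nm) (leq_ltn_trans (leq_subr _ _) lt_nm).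
Qed.

Let coefM_eq (n : nat) (p p' r r' : {poly R}) :
  (forall i, (i <= n)%N -> p`_i = p'`_i) ->
  (forall i, (i <= n)%N -> r`_i = r'`_i) -> (p * r)`_n = (p' * r')`_n.
Proof.
move=> Hp Hr; rewrite !coefM; apply: eq_bigr => i _.
by rewrite Hp ?Hr ?leq_subr // -ltnS.
Qed.

Let trunc_mulE m i f g : (i < m)%N ->
  (trunc m (fps_mul f g))`_i = (trunc m f * trunc m g)`_i.
Proof. by move=> lt_im; rewrite coef_poly lt_im; exact: trunc_mul. Qed.

Fact fps_mulC : commutative fps_mul.
Proof.
by move=> f g; apply/fpsP => n; rewrite !(@trunc_mul n.+1) // mulrC.
Qed.
Fact fps_mulA : associative fps_mul.
Proof.
move=> f g h; apply/fpsP => n; rewrite !(@trunc_mul n.+1) //.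
transitivity ((trunc n.+1 f * (trunc n.+1 g * trunc n.+1 h))`_n).
  by apply: coefM_eq => // i le_in; exact: trunc_mulE.
by rewrite mulrA; apply: coefM_eq => // i le_in; rewrite trunc_mulE.
Qed.
Fact fps_mul1 : left_id (fpsC 1) fps_mul.
Proof.
move=> f; apply/fpsP => n /=; rewrite big_ord_recl /= subn0 mul1r big1 ?addr0 //.
by move=> i _; rewrite mul0r.
Qed.
Fact fps_mulD : left_distributive fps_mul fps_add.
Proof.
move=> f g h; apply/fpsP => n /=; rewrite -big_split /=.
by apply: eq_bigr => i _; rewrite mulrDl.
Qed.
Fact fps_1neq0 : fpsC 1 != fpsC 0.
Proof.
by apply/eqP => /(congr1 (fun f => fps_coef f 0)) /eqP /=; rewrite oner_eq0.
Qed.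

HB.instance Definition _ := GRing.Zmodule_isComNzRing.Build (fps R)
  fps_mulA fps_mulC fps_mul1 fps_mulD fps_1neq0.

End FpsRing.

Arguments fpsX {R}.
Notation "c %:S" := (fpsC c) (at level 2, format "c %:S")
  : ring_scope.

Section FpsUnitRing.
Variable K : fieldType.
Implicit Types f g : fps K.

(* [fps_inv_seq f n] lists the first [n] coefficients of the inverse of [f]. *)
Fixpoint fps_inv_seq f (n : nat) : seq K :=
  if n is m.+1 then
    let s := fps_inv_seq f m in
    rcons s ((fps_coef f 0)^-1 *
      ((m == 0%N)%:R - \sum_(i < m) fps_coef f (m - i)%N * s`_i))
  else [::].

Definition fps_unit : pred (fps K) := fun f => fps_coef f 0 != 0.

Definition fps_inv f : fps K :=
  if fps_unit f then Fps (fun n => (fps_inv_seq f n.+1)`_n) else f.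

Let size_fps_inv_seq f n : size (fps_inv_seq f n) = n.
Proof. by elim: n => //= n IHn; rewrite size_rcons IHn. Qed.

Let nth_fps_inv_seq f n i : (i < n)%N ->
  (fps_inv_seq f n)`_i = (fps_inv_seq f i.+1)`_i.
Proof.
elim: n => // n IHn; rewrite ltnS leq_eqVlt => /predU1P[-> //|lt_in].
by rewrite /= nth_rcons size_fps_inv_seq lt_in IHn.
Qed.

Fact fps_mulV : {in fps_unit, left_inverse 1 fps_inv *%R}.
Proof.
move=> f uf; rewrite mulrC; apply/fpsP => n.
rewrite /fps_inv (uf : fps_unit f) /GRing.mul /= big_ord_recl /= subn0.
rewrite nth_rcons size_fps_inv_seq ltnn eqxx mulVKf //.
rewrite [X in _ + X](_ : _ =
  \sum_(i < n) fps_coef f (n - i)%N * (fps_inv_seq f n)`_i); last first.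
  rewrite (reindex_inj rev_ord_inj) /=; apply: eq_bigr => i _.
  have -> : bump 0 (n - i.+1) = (n - i)%N by rewrite /bump add1n subnSK.
  rewrite subKn 1?ltnW // (nth_fps_inv_seq f (ltn_ord i)) /=.
  by rewrite !nth_rcons size_fps_inv_seq ltnn eqxx.
by rewrite subrK; case: (n).
Qed.

Fact fps_unitPl f g : g * f = 1 -> fps_unit f.
Proof.
move=> /(congr1 (fun h => fps_coef h 0)); rewrite /GRing.mul /= big_ord1 => gf1.
apply/eqP => f0; move/eqP: gf1.
by rewrite subnn f0 mulr0 eq_sym oner_eq0.
Qed.

Fact fps_inv_out : {in [predC fps_unit], fps_inv =1 id}.
Proof. by move=> f uf; rewrite /fps_inv ifN. Qed.

HB.instance Definition _ := GRing.ComNzRing_hasMulInverse.Build (fps K)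
  fps_mulV fps_unitPl fps_inv_out.

End FpsUnitRing.

(* Limits of formal power series are taken coefficient by coefficient, in the
   topology of [K]. *)
Definition fps_lim (K : numFieldType) (u : nat -> fps K) : fps K :=
  Fps (fun n => limn (fun N => fps_coef (u N) n)).

Definition fps_series (K : numFieldType) (u : nat -> fps K) : fps K :=
  fps_lim (fun N => \sum_(k < N) u k).

Definition qpoch (A : comNzRingType) (q z : A) (n : nat) : A :=
  \prod_(i < n) (1 - z * q ^+ i).

Definition qpochs (A : comNzRingType) (q : A) (zs : seq A) (n : nat) : A :=
  \prod_(z <- zs) qpoch q z n.

Definition qpoch_infty (K : numFieldType) (q : K) (z : fps K) : fps K :=
  fps_lim (fun N => qpoch q%:S z N).

Definition qpochs_infty (K : numFieldType) (q : K) (zs : seq (fps K)) : fps K :=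
  \prod_(z <- zs) qpoch_infty q z.

Section AskeyWilson.
Variable R : realType.
Local Notation C := R[i].
Implicit Types q a b c d theta z : C.

Definition expC z : C :=
  Complex (expR (complex.Re z) * cos (complex.Im z))
          (expR (complex.Re z) * sin (complex.Im z)).

Definition cosC theta : C := (expC ('i%C * theta) + expC (- ('i%C * theta))) / 2.

Definition askey_wilson_sum q n a b c d theta : C :=
  qpochs q [:: a * b; a * c; a * d] n / a ^+ n *
  \sum_(k < n.+1)
    qpochs q [:: q ^- n; a * b * c * d * (q ^+ n / q);
                 a * expC ('i%C * theta); a * expC (- ('i%C * theta))] k
    / qpochs q [:: q; a * b; a * c; a * d] k * q ^+ k.

(* Polynomials in [x] whose coefficients are polynomials in [a, b, c, d]. *)
Definition aw_family := {poly mpoly 4 C}.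

Definition aw_eval (P : aw_family) a b c d : {poly C} :=
  map_poly (meval (tnth [tuple a; b; c; d])) P.

(* Division by zero is total here, so the values of [askey_wilson_sum] are only
   used where the denominators [a] and [(ab, ac, ad)_n] do not vanish; these
   values determine [P]. *)
Definition is_askey_wilson q n (P : aw_family) : Prop :=
  forall a b c d theta, a != 0 -> qpochs q [:: a * b; a * c; a * d] n != 0 ->
    (aw_eval P a b c d).[cosC theta] = askey_wilson_sum q n a b c d theta.

Definition askey_wilson_family q n : aw_family :=
  xget 0 [set P | is_askey_wilson q n P]%classic.

Definition askey_wilson q n a b c d : {poly C} :=
  aw_eval (askey_wilson_family q n) a b c d.

End AskeyWilson.

(* Main.v *)
From HB Require Import structures.
Require Import Defs.
From mathcomp Require Import all_boot all_order all_algebra.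
From mathcomp Require Import all_classical all_reals all_analysis.
From mathcomp Require Import ring zify.
From mathcomp Require Import -(notations) mpoly.

Set Implicit Arguments.
Unset Strict Implicit.
Unset Printing Implicit Defensive.

Import Order.TTheory GRing.Theory Num.Theory.
Import numFieldNormedType.Exports.
Local Open Scope ring_scope.

(** Write [z] and [w] for [e^{i theta}] and [e^{-i theta}], so that [z w = 1] and
    [2 x = z + w], and let [n choose j] be the [q]-binomial coefficient.  The proof
    adds the parameters [a], [b], [c], [d] one at a time.

    The one-parameter polynomials [H_n(a)] are given by the three-term recurrence
    of the continuous big [q]-Hermite polynomials.  Adding a parameter is a finite
    sum with [q]-binomial weights:
    [p_n(a,b) = sum_j (n choose j) (-b)^(n-j) q^C(n-j,2) H_j(a)], then
    [p_n(a,b,c) = sum_j (n choose j) (-c)^(n-j) q^C(n-j,2) (ab q^j)_(n-j) p_j(a,b)],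
    and [p_n(a,b,c,d)] is obtained from [p_j(a,b,c)] by a sum of the same shape.
    No division occurs, so these are polynomials in [a], [b], [c], [d] and [x].
    Multiplied by [a^n] and expanded on the products [(az, aw)_k], they have the
    coefficients of the Askey-Wilson sum ([aw_poly_sum]): the recurrence shows it
    for [H_n] ([big_qhermite_sum]), and at every further step it amounts, after
    exchanging two sums ([sum_qbin_aw_coef]), to an instance of the terminating
    summation [sum_qbin_qpoch2].  Hence the polynomial family that the definition
    of the Askey-Wilson polynomials asks for exists.  Its values at [d = 0] are
    [p_n(a,b,c)] for every [a], the exceptional values included, because both are
    polynomials in [a] which agree outside a finite set ([askey_wilson_horner]).

    For the generating function, let [E(u) = (ut)_oo], with Euler's expansion
    [sum_n (-u)^n q^C(n,2) / (q)_n t^n] ([qpoch_infty_euler_series]).  The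
    recurrence of [H_n] is a first-order [q]-difference equation for
    [sum_n H_n t^n / (q)_n], which therefore is [E(a) / (E(z) E(w))].  The step
    from [H_n] to [p_n(a,b)] is the multiplication of that series by [E(b)].
    Finally [E(abc) / (abct)_k = E(abc q^k)] clears the denominators in [t] on the
    left-hand side, and [sum_k p_k(a,b,c) / (q)_k t^k E(abc q^k)] is the product of
    [sum_n p_n(a,b) t^n / (q)_n] and [E(c)]: comparing the coefficients of [t^n],
    this is the summation [sum_qbin_qpoch]. *)

(** * q-shifted factorials and q-binomial sums *)

(** Defined by [q]-Pascal recursion, hence without division, so that it commutes
    with all ring morphisms and can be used inside polynomial rings. *)
Fixpoint qbin (A : comNzRingType) (q : A) (n k : nat) : A :=
  match n, k with
  | _, 0 => 1
  | 0, _.+1 => 0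
  | n'.+1, k'.+1 => qbin q n' k' + q ^+ k * qbin q n' k
  end.

Arguments qbin : simpl never.

Section QBinomial.
Variable A : comNzRingType.
Implicit Types q z u v : A.

Lemma qpoch0 q z : qpoch q z 0 = 1.
Proof. by rewrite /qpoch big_ord0. Qed.

Lemma qpochS q z n : qpoch q z n.+1 = qpoch q z n * (1 - z * q ^+ n).
Proof. by rewrite /qpoch big_ord_recr. Qed.

Lemma qpochSl q z n : qpoch q z n.+1 = (1 - z) * qpoch q (z * q) n.
Proof.
rewrite /qpoch big_ord_recl expr0 mulr1; congr (_ * _).
by apply: eq_bigr => i _; rewrite -mulrA -exprS.
Qed.

Lemma qpochD q z m n : qpoch q z (m + n) = qpoch q z m * qpoch q (z * q ^+ m) n.
Proof.
elim: n => [|n IHn]; first by rewrite addn0 qpoch0 mulr1.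
by rewrite addnS !qpochS IHn exprD !mulrA.
Qed.

Lemma qpoch_split q z m n : (m <= n)%N ->
  qpoch q z n = qpoch q z m * qpoch q (z * q ^+ m) (n - m).
Proof. by move=> le_mn; rewrite -qpochD subnKC. Qed.

Lemma qpoch_zero q n : qpoch q 0 n = 1.
Proof. by rewrite /qpoch big1 // => i _; rewrite mul0r subr0. Qed.

Lemma qbin0 q n : qbin q n 0 = 1.
Proof. by case: n. Qed.

Lemma qbinS q n k :
  qbin q n.+1 k.+1 = qbin q n k + q ^+ k.+1 * qbin q n k.+1.
Proof. by []. Qed.

Lemma qbin_small q n k : (n < k)%N -> qbin q n k = 0.
Proof.
elim: n k => [|n IHn] [|k] //; rewrite ltnS => lt_nk.
by rewrite qbinS !IHn ?ltnS // ?mulr0 ?addr0 // ltnW.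
Qed.

Lemma qbin_qpoch q n k : (k <= n)%N ->
  qbin q n k * (qpoch q q k * qpoch q q (n - k)) = qpoch q q n.
Proof.
elim: n k => [|n IHn] [|k] //; rewrite ?qbin0 ?qpoch0 ?subn0 ?mul1r //.
rewrite ltnS subSS qbinS => le_kn; rewrite mulrDl (qpochS q q k).
rewrite [X in X + _ = _](_ : _ = (1 - q * q ^+ k) *
  (qbin q n k * (qpoch q q k * qpoch q q (n - k)))); last by ring.
rewrite IHn //; move: le_kn; rewrite leq_eqVlt => /predU1P[->|lt_kn].
  by rewrite qbin_small // qpochS; ring.
rewrite -(subnSK lt_kn) (qpochS q q (n - k.+1)).
rewrite [X in _ + X = _](_ : _ = q ^+ k.+1 * (1 - q * q ^+ (n - k.+1)) *
  (qbin q n k.+1 * (qpoch q q k.+1 * qpoch q q (n - k.+1)))); last first.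
  by rewrite qpochS; ring.
rewrite IHn // qpochS.
have -> : q ^+ n = q ^+ k.+1 * q ^+ (n - k.+1) by rewrite -exprD subnKC.
by rewrite exprS; ring.
Qed.

Lemma sum_qbinS q n (f : nat -> A) :
  \sum_(k < n.+2) qbin q n.+1 k * f k =
  \sum_(k < n.+1) qbin q n k * (f k.+1 + q ^+ k * f k).
Proof.
under [RHS]eq_bigr do rewrite mulrDr.
rewrite [RHS]big_split /= big_ord_recl qbin0.
have -> : \sum_(i < n.+1) qbin q n i * (q ^+ i * f i) =
    \sum_(i < n.+2) qbin q n i * (q ^+ i * f i).
  by rewrite [RHS]big_ord_recr /= qbin_small // mul0r addr0.
rewrite [X in _ = _ + X]big_ord_recl qbin0 expr0 addrCA; congr (_ + _).
  by rewrite !mul1r.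
rewrite -big_split /=; apply: eq_bigr => i _.
by rewrite /bump /= add1n qbinS; ring.
Qed.

(** By [q]-Pascal, passing from [n] to [n + 1] multiplies the [k]-th term by
    [(1 - v q^k) + v q^k = 1]. *)
Lemma sum_qbin_qpoch q v n :
  \sum_(k < n.+1) qbin q n k * (qpoch q v k * v ^+ (n - k)) = 1.
Proof.
elim: n => [|n IHn]; first by rewrite big_ord1 qpoch0 !mul1r.
rewrite (sum_qbinS q n (fun k => qpoch q v k * v ^+ (n.+1 - k))) -IHn.
apply: eq_bigr => k _; have le_kn : (k <= n)%N by rewrite -ltnS.
rewrite subSS subSn // qpochS exprS; ring.
Qed.

(** A terminating [q]-Vandermonde summation.  [q]-Pascal turns the sum for
    [(n + 1, u, v)] into [1 - u q^n] times the sum for [(n, u, v q)], since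
    [(1 - u v q^(n+k)) - u q^n (1 - v q^k) = 1 - u q^n]; so the
    value does not depend on [v]. *)
Lemma sum_qbin_qpoch2 q u v n :
  \sum_(k < n.+1) qbin q n k *
    ((- u) ^+ (n - k) * q ^+ 'C(n - k, 2) * qpoch q (v * q ^+ k) (n - k)
     * qpoch q (u * v * q ^+ n.-1) k) = qpoch q u n.
Proof.
elim: n v => [|n IHn] v; first by rewrite big_ord1 !qpoch0 !mul1r.
rewrite (sum_qbinS q n (fun k => (- u) ^+ (n.+1 - k) * q ^+ 'C(n.+1 - k, 2)
  * qpoch q (v * q ^+ k) (n.+1 - k) * qpoch q (u * v * q ^+ n) k)).
rewrite qpochS -(IHn (v * q)) mulr_suml; apply: eq_bigr => k _.
have le_kn : (k <= n)%N by rewrite -ltnS.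
rewrite subSS subSn // qpochS binS bin1 exprD (exprS (- u)) qpochSl.
have -> : v * q * q ^+ k = v * q ^+ k.+1 by rewrite exprS mulrA.
have -> : v * q ^+ k * q = v * q ^+ k.+1 by rewrite exprSr mulrA.
have -> : qpoch q (u * (v * q) * q ^+ n.-1) k = qpoch q (u * v * q ^+ n) k.
  case: n k le_kn {IHn} => [|n] k le_kn; last by rewrite exprS /= !mulrA.
  by move: le_kn; rewrite leqn0 => /eqP ->; rewrite !qpoch0.
have -> : q ^+ n = q ^+ k * q ^+ (n - k) by rewrite -exprD subnKC.
by ring.
Qed.

(** Gauss's [q]-binomial theorem, the case [v = 0] of the summation above. *)
Lemma qbinomial q u n :
  \sum_(k < n.+1) qbin q n k * ((- u) ^+ (n - k) * q ^+ 'C(n - k, 2)) =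
  qpoch q u n.
Proof.
rewrite -(sum_qbin_qpoch2 q u 0 n); apply: eq_bigr => k _.
by rewrite mulr0 !mul0r !qpoch_zero !mulr1.
Qed.

Lemma sum_triangle n (G : nat -> nat -> A) :
  \sum_(j < n.+1) \sum_(k < j.+1) G j k =
  \sum_(k < n.+1) \sum_(i < (n - k).+1) G (k + i)%N k.
Proof.
elim: n => [|n IHn]; first by rewrite !big_ord1.
rewrite big_ord_recr /= IHn [RHS]big_ord_recr /= subnn big_ord1 addn0.
rewrite [X in _ + X]big_ord_recr /= addrA; congr (_ + _).
rewrite -big_split /=; apply: eq_bigr => k _.
have le_kn : (k <= n)%N by rewrite -ltnS.
by rewrite subSn // [RHS]big_ord_recr /= addnS subnKC.
Qed.

End QBinomial.

(** * Division-free construction of the polynomials *)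

Section AskeyWilsonPolynomials.
Variable A : comNzRingType.
Variables q a b c d y : A.

(** In this section [y] stands for [2 x].  The inner [if] only supplies the
    value [0] for the missing polynomial of index [-1]. *)
Fixpoint big_qhermite (n : nat) : A :=
  if n is m.+1 then
    (y - a * q ^+ m) * big_qhermite m
    - (1 - q ^+ m) * (if m is l.+1 then big_qhermite l else 0)
  else 1.

Definition al_salam_chihara n : A :=
  \sum_(j < n.+1) qbin q n j *
    ((- b) ^+ (n - j) * q ^+ 'C(n - j, 2) * big_qhermite j).

Definition dual_qhahn n : A :=
  \sum_(j < n.+1) qbin q n j *
    ((- c) ^+ (n - j) * q ^+ 'C(n - j, 2) * qpoch q (a * b * q ^+ j) (n - j)
     * al_salam_chihara j).

(** The weights are the connection coefficients from [d = 0] to arbitrary [d].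
    For [n = 0] the factor containing [q ^+ n.-1] is an empty product. *)
Definition aw_poly n : A :=
  \sum_(j < n.+1) qbin q n j *
    ((- d) ^+ (n - j) * q ^+ 'C(n - j, 2)
     * (qpoch q (a * b * q ^+ j) (n - j) * qpoch q (a * c * q ^+ j) (n - j)
        * qpoch q (b * c * q ^+ j) (n - j))
     * qpoch q (a * b * c * d * q ^+ n.-1) j * dual_qhahn j).

End AskeyWilsonPolynomials.

Lemma aw_poly0 (A : comNzRingType) (q a b c y : A) n :
  aw_poly q a b c 0 y n = dual_qhahn q a b c y n.
Proof.
rewrite /aw_poly big_ord_recr /= big1 ?add0r => [|j _].
  rewrite subnn bin0n !qpoch0 mulr0 mul0r qpoch_zero !mul1r.
  suff -> : qbin q n n = 1 by rewrite mul1r.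
  by elim: n => // n IHn; rewrite qbinS IHn qbin_small // mulr0 addr0.
by rewrite oppr0 expr0n subn_eq0 leqNgt ltn_ord /= !mul0r mulr0.
Qed.

Section Morphism.
Variables (A B : comNzRingType) (f : {rmorphism A -> B}).
Implicit Types q a b c d y z : A.

Lemma rmorph_qpoch q z n : f (qpoch q z n) = qpoch (f q) (f z) n.
Proof.
rewrite rmorph_prod; apply: eq_bigr => i _.
by rewrite rmorphB rmorph1 rmorphM rmorphXn.
Qed.

Lemma rmorph_qbin q n k : f (qbin q n k) = qbin (f q) n k.
Proof.
elim: n k => [|n IHn] [|k]; rewrite ?qbin0 ?rmorph1 ?rmorph0 //.
by rewrite !qbinS rmorphD rmorphM rmorphXn !IHn.
Qed.

Lemma rmorph_big_qhermite q a y n :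
  f (big_qhermite q a y n) = big_qhermite (f q) (f a) (f y) n.
Proof.
have [m] := ubnP n; elim: m n => // m IHm [|n] lt_nm; first exact: rmorph1.
rewrite /= rmorphB !rmorphM !rmorphB rmorphM rmorph1 !rmorphXn IHm //.
case: n lt_nm => [|n] lt_nm; first by rewrite rmorph0.
by rewrite IHm // ltnW.
Qed.

(** Lets one construction serve as a formal polynomial, as a polynomial in [a]
    alone, and as a number. *)
Lemma rmorph_aw_poly q a b c d y n :
  f (aw_poly q a b c d y n) = aw_poly (f q) (f a) (f b) (f c) (f d) (f y) n.
Proof.
have rE := (rmorph_qbin, rmorph_qpoch, rmorph_big_qhermite,
  rmorphM, rmorphXn, rmorphN).
rewrite rmorph_sum; apply: eq_bigr => i _; rewrite !rE; congr (_ * (_ * _)).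
rewrite rmorph_sum; apply: eq_bigr => j _; rewrite !rE; congr (_ * (_ * _)).
by rewrite rmorph_sum; apply: eq_bigr => k _; rewrite !rE.
Qed.

End Morphism.

(** * Expansion on the basis (az, aw)_k *)

Lemma exprNM (A : comNzRingType) (x y : A) n :
  (- (x * y)) ^+ n = (- x) ^+ n * y ^+ n.
Proof. by rewrite -mulNr exprMn. Qed.

Section Terminating.
Variables (K : fieldType) (q : K).
Hypothesis q_neq0 : q != 0.
Hypothesis qfact_neq0 : forall n, qpoch q q n != 0.

Lemma qbinE n k : (k <= n)%N ->
  qbin q n k = qpoch q q n / (qpoch q q k * qpoch q q (n - k)).
Proof.
by move=> le_kn; rewrite -(qbin_qpoch q le_kn) mulfK // mulf_neq0.
Qed.

Lemma qbin_mul n k i : (k + i <= n)%N ->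
  qbin q n (k + i) * qbin q (k + i) k = qbin q n k * qbin q (n - k) i.
Proof.
move=> le_n; have le_kn : (k <= n)%N by apply: leq_trans le_n; rewrite leq_addr.
have le_i : (i <= n - k)%N by rewrite leq_subRL.
rewrite !qbinE ?leq_addr // addKn subnDA.
by field; rewrite !qfact_neq0.
Qed.

Lemma qbin_subr n k : qbin q n k * (1 - q ^+ (n - k)) = (1 - q ^+ n) * qbin q n.-1 k.
Proof.
have [lt_kn|] := ltnP k n; last first.
  rewrite leq_eqVlt => /predU1P[<-|lt_nk].
    rewrite subnn subrr mulr0; case: n => [|n]; first by rewrite subrr mul0r.
    by rewrite qbin_small // mulr0.
  by rewrite !qbin_small ?mul0r ?mulr0 // (leq_ltn_trans (leq_pred n)).
case: n lt_kn => // n; rewrite ltnS => le_kn.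
rewrite !qbinE // 1?ltnW // subSn // !qpochS -!exprS /=.
have := qfact_neq0 (n - k).+1; rewrite qpochS -exprS mulf_eq0 => /norP[_ nz].
by field; rewrite !qfact_neq0.
Qed.

Lemma qbinS_alt n k : (k <= n)%N ->
  qbin q n.+1 k.+1 = q ^+ (n - k) * qbin q n k + qbin q n k.+1.
Proof.
rewrite leq_eqVlt => /predU1P[->|lt_kn].
  by rewrite qbinS subnn expr0 mul1r (qbin_small _ (ltnSn n)) mulr0.
rewrite qbinS !qbinE // 1?ltnW // -(subnSK lt_kn) !qpochS -!exprS.
have nz m : 1 - q ^+ m.+1 != 0.
  by have := qfact_neq0 m.+1; rewrite qpochS -exprS mulf_eq0 => /norP[].
by field; rewrite !qfact_neq0 !nz.
Qed.

Lemma sum_qbinS_alt n (f : nat -> K) :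
  \sum_(k < n.+2) qbin q n.+1 k * f k =
  \sum_(k < n.+1) qbin q n k * (f k + q ^+ (n - k) * f k.+1).
Proof.
under [RHS]eq_bigr do rewrite mulrDr.
rewrite [RHS]big_split /= big_ord_recl qbin0.
have -> : \sum_(i < n.+1) qbin q n i * f i = \sum_(i < n.+2) qbin q n i * f i.
  by rewrite [RHS]big_ord_recr /= qbin_small // mul0r addr0.
rewrite [X in _ = X + _]big_ord_recl qbin0 -addrA; congr (_ + _).
rewrite -big_split /=; apply: eq_bigr => i _.
have le_in : (i <= n)%N by rewrite -ltnS.
by rewrite /bump /= add1n qbinS_alt //; ring.
Qed.

(** The factor [(q^-n)_k / (q)_k q^k] of the Askey-Wilson sum, in a form which
    multiplies well with [q]-binomial coefficients. *)
Definition aw_coef n k : K :=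
  qbin q n k * ((-1) ^+ k * q ^+ 'C(k, 2) * q ^+ k * q^-1 ^+ (n * k)).

Lemma aw_coefE n k : (k <= n)%N ->
  aw_coef n k = qpoch q (q ^- n) k / qpoch q q k * q ^+ k.
Proof.
move=> le_kn; rewrite /aw_coef qbinE //.
suff -> : qpoch q (q ^- n) k = (-1) ^+ k * q ^+ 'C(k, 2) * q^-1 ^+ (n * k)
    * qpoch q q n / qpoch q q (n - k).
  by field; rewrite !qfact_neq0.
apply: (canRL (mulfK _)) => //.
elim: k le_kn => [|k IHk] lt_kn.
  by rewrite qpoch0 subn0 muln0 !mul1r.
have := IHk (ltnW lt_kn); rewrite -(subnSK lt_kn) !qpochS -exprS subnSK //.
rewrite binS bin1 !exprD mulnS exprD exprS => IH.
transitivity (- (q ^+ k * q^-1 ^+ n) *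
  (qpoch q (q ^- n) k * (qpoch q q (n - k.+1) * (1 - q ^+ (n - k)))));
  last by rewrite IH; ring.
have -> : q ^- n * q ^+ k = q ^- (n - k).
  rewrite -[in LHS](subnKC (ltnW lt_kn)) exprD invfM mulrAC mulVf ?mul1r //.
  by rewrite expf_neq0.
have -> : q ^+ k * q^-1 ^+ n = q ^- (n - k).
  rewrite exprVn -[in LHS](subnKC (ltnW lt_kn)) exprD invfM mulrA mulfV ?mul1r //.
  by rewrite expf_neq0.
by field; rewrite expf_neq0.
Qed.

Lemma aw_coef_sub n k :
  aw_coef n.+1 k * (q ^+ k - q ^+ n.+1) = (1 - q ^+ n.+1) * aw_coef n k.
Proof.
have [lt_k|le_k] := ltnP n.+1 k.
  by rewrite /aw_coef !qbin_small ?mul0r ?mulr0 // ltnW.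
have /= qbin_n := qbin_subr n.+1 k; 
rewrite /aw_coef [RHS]mulrA -qbin_n mulSn exprD exprVn.
have -> : q ^+ n.+1 = q ^+ k * q ^+ (n.+1 - k) by rewrite -exprD subnKC.
by field; rewrite expf_neq0.
Qed.

Lemma sum_aw_coefS n (phi : nat -> K) :
  \sum_(k < n.+2) aw_coef n.+1 k * phi k =
  \sum_(k < n.+1) aw_coef n k * (q ^- k * (phi k - phi k.+1)).
Proof.
pose f k := (-1) ^+ k * q ^+ 'C(k, 2) * q ^+ k * q^-1 ^+ (n.+1 * k) * phi k.
transitivity (\sum_(k < n.+2) qbin q n.+1 k * f k).
  by apply: eq_bigr => k _; rewrite /f mulrA.
rewrite sum_qbinS_alt; apply: eq_bigr => k _; rewrite -[RHS]mulrA.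
congr (_ * _); rewrite /f.
have le_kn : (k <= n)%N by rewrite -ltnS.
have -> : q^-1 ^+ (n.+1 * k) = q^-1 ^+ k * q^-1 ^+ (n * k).
  by rewrite mulSn exprD.
have -> : q^-1 ^+ (n.+1 * k.+1) =
    q^-1 * q^-1 ^+ n * (q^-1 ^+ k * q^-1 ^+ (n * k)).
  by rewrite mulnS exprD exprS mulSn exprD.
rewrite binS bin1 exprD !(exprS _ k) !exprVn.
have -> : q ^+ n = q ^+ k * q ^+ (n - k) by rewrite -exprD subnKC.
by field; rewrite !expf_neq0.
Qed.

(** The step common to adding [b], [c] and [d]: by
    [(n choose k+i) (k+i choose k) = (n choose k) (n-k choose i)], a [q]-binomial
    combination of expansions on a basis indexed by [k] is again such an expansion,
    whose new coefficients are [q]-binomial sums over [i]. *)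
Lemma sum_qbin_aw_coef n (W : nat -> K) (h : nat -> nat -> K) :
  \sum_(j < n.+1) qbin q n j * (W j * \sum_(k < j.+1) aw_coef j k * h j k) =
  \sum_(k < n.+1) aw_coef n k * \sum_(i < (n - k).+1) qbin q (n - k) i *
    ((q ^+ k) ^+ (n - k - i) * W (k + i)%N * h (k + i)%N k).
Proof.
under eq_bigr do rewrite !mulr_sumr.
rewrite (sum_triangle n (fun j k =>
  qbin q n j * (W j * (aw_coef j k * h j k)))).
apply: eq_bigr => k _; rewrite mulr_sumr; apply: eq_bigr => i _.
have le_kn : (k <= n)%N by rewrite -ltnS.
have le_i : (i <= n - k)%N by rewrite -ltnS.
have le_n : (k + i <= n)%N by rewrite -leq_subRL.
rewrite /aw_coef.
transitivity (qbin q n (k + i) * qbin q (k + i) k * (W (k + i)%N * h (k + i)%N k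
  * ((-1) ^+ k * q ^+ 'C(k, 2) * q ^+ k * q^-1 ^+ ((k + i) * k)))); first by ring.
rewrite qbin_mul // -exprM -subnDA.
have -> : q^-1 ^+ ((k + i) * k) = q^-1 ^+ (n * k) * q ^+ (k * (n - (k + i))).
  have -> : (n * k = (k + i) * k + k * (n - (k + i)))%N.
    by rewrite (mulnC k (n - _)%N) -mulnDl subnKC.
  rewrite exprD -mulrA exprVn (exprVn _ (k * _)) mulVf ?mulr1 //.
  by rewrite expf_neq0.
by ring.
Qed.

Section Evaluation.
Variables (a b c d z w : K).
Hypothesis zw1 : z * w = 1.

Let phi k := qpoch q (a * z) k * qpoch q (a * w) k.

(** With [phi_k = (az, aw)_k] and [z w = 1],
    [a (z + w) phi_k = q^-k (phi_k - phi_(k+1)) + a^2 q^k phi_k].  So the three-term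
    recurrence follows from two identities between the coefficients: [sum_aw_coefS]
    accounts for the first summand, [aw_coef_sub] for the second one. *)
Lemma big_qhermite_sum n :
  a ^+ n * big_qhermite q a (z + w) n = \sum_(k < n.+1) aw_coef n k * phi k.
Proof.
have coef0 : aw_coef 0 0 = 1 by rewrite /aw_coef !mulr1.
have [m] := ubnP n; elim: m n => // m IHm [|n] lt_nm.
  by rewrite big_ord1 coef0 /phi !qpoch0 !mulr1.
rewrite sum_aw_coefS.
transitivity (a * (z + w - a * q ^+ n) * (\sum_(k < n.+1) aw_coef n k * phi k)
    - a ^+ 2 * (\sum_(k < n.+1) aw_coef n k * (q ^+ k - q ^+ n) * phi k)).
  have -> : \sum_(k < n.+1) aw_coef n k * (q ^+ k - q ^+ n) * phi k =
     (1 - q ^+ n) * (if n is l.+1 then a ^+ l * big_qhermite q a (z + w) l else 0).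
    case: n lt_nm => [|n] lt_nm; first by rewrite big_ord1 subrr !mulr0 mul0r.
    rewrite (IHm n (ltnW lt_nm)) big_ord_recr /= subrr mulr0 mul0r addr0 mulr_sumr.
    by apply: eq_bigr => k _; rewrite aw_coef_sub -mulrA.
  rewrite -IHm //=; case: n {lt_nm} => [|n]; rewrite !exprS; ring.
rewrite !mulr_sumr -sumrB; apply: eq_bigr => k _.
have -> : phi k.+1 = phi k * (1 - a * (z + w) * q ^+ k + a ^+ 2 * (q ^+ k) ^+ 2).
  rewrite /phi !qpochS; set Z := q ^+ k.
  transitivity (qpoch q (a * z) k * qpoch q (a * w) k *
    (1 - a * (z + w) * Z + a ^+ 2 * Z ^+ 2 * (z * w))); first by ring.
  by rewrite zw1; ring.
by field; rewrite expf_neq0.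
Qed.

Lemma al_salam_chihara_sum n :
  a ^+ n * al_salam_chihara q a b (z + w) n =
  \sum_(k < n.+1) aw_coef n k * (phi k * qpoch q (a * b * q ^+ k) (n - k)).
Proof.
pose W j := (- (a * b)) ^+ (n - j) * q ^+ 'C(n - j, 2).
transitivity (\sum_(j < n.+1) qbin q n j *
    (W j * \sum_(k < j.+1) aw_coef j k * phi k)).
  rewrite mulr_sumr; apply: eq_bigr => j _; rewrite -big_qhermite_sum /W.
  have le_jn : (j <= n)%N by rewrite -ltnS.
  rewrite -{1}(subnK le_jn) exprD -mulrN exprMn; ring.
rewrite (sum_qbin_aw_coef n W (fun _ k => phi k)); apply: eq_bigr => k _.
congr (_ * _); rewrite -qbinomial mulr_sumr; apply: eq_bigr => i _.
by rewrite /W subnDA (exprNM (a * b)); ring.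
Qed.

Lemma dual_qhahn_sum n :
  a ^+ n * dual_qhahn q a b c (z + w) n =
  \sum_(k < n.+1) aw_coef n k * (phi k * (qpoch q (a * b * q ^+ k) (n - k)
     * qpoch q (a * c * q ^+ k) (n - k))).
Proof.
pose W j := (- (a * c)) ^+ (n - j) * q ^+ 'C(n - j, 2)
  * qpoch q (a * b * q ^+ j) (n - j).
transitivity (\sum_(j < n.+1) qbin q n j * (W j * \sum_(k < j.+1)
    aw_coef j k * (phi k * qpoch q (a * b * q ^+ k) (j - k)))).
  rewrite mulr_sumr; apply: eq_bigr => j _; rewrite -al_salam_chihara_sum /W.
  have le_jn : (j <= n)%N by rewrite -ltnS.
  rewrite -{1}(subnK le_jn) exprD -mulrN exprMn; ring.
rewrite (sum_qbin_aw_coef n W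
  (fun j k => phi k * qpoch q (a * b * q ^+ k) (j - k))).
apply: eq_bigr => k _; congr (_ * _).
rewrite -(qbinomial _ (a * c * q ^+ k)) !mulr_sumr; apply: eq_bigr => i _.
have le_i : (i <= n - k)%N by rewrite -ltnS.
rewrite /W subnDA (exprNM (a * c)) addKn.
rewrite (qpoch_split q (a * b * q ^+ k) le_i) exprD -!mulrA; ring.
Qed.

(** Adding [d] uses [sum_qbin_qpoch2] at [u = a d q^k], [v = b c q^k]; the factors
    [(abcd q^(n-1))_j] split off [(abcd q^(n-1))_k], which is common to all terms. *)
Lemma aw_poly_sum n :
  a ^+ n * aw_poly q a b c d (z + w) n =
  \sum_(k < n.+1) aw_coef n k * (phi k * (qpoch q (a * b * q ^+ k) (n - k)
     * qpoch q (a * c * q ^+ k) (n - k) * qpoch q (a * d * q ^+ k) (n - k))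
     * qpoch q (a * b * c * d * q ^+ n.-1) k).
Proof.
pose W j := (- (a * d)) ^+ (n - j) * q ^+ 'C(n - j, 2)
  * (qpoch q (a * b * q ^+ j) (n - j) * qpoch q (a * c * q ^+ j) (n - j)
     * qpoch q (b * c * q ^+ j) (n - j)) * qpoch q (a * b * c * d * q ^+ n.-1) j.
transitivity (\sum_(j < n.+1) qbin q n j * (W j * \sum_(k < j.+1)
    aw_coef j k * (phi k * (qpoch q (a * b * q ^+ k) (j - k)
      * qpoch q (a * c * q ^+ k) (j - k))))).
  rewrite mulr_sumr; apply: eq_bigr => j _; rewrite -dual_qhahn_sum /W.
  have le_jn : (j <= n)%N by rewrite -ltnS.
  rewrite -{1}(subnK le_jn) exprD -mulrN exprMn; ring.
rewrite (sum_qbin_aw_coef n W (fun j k => phi k *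
  (qpoch q (a * b * q ^+ k) (j - k) * qpoch q (a * c * q ^+ k) (j - k)))).
apply: eq_bigr => k _; congr (_ * _).
have le_kn : (k <= n)%N by rewrite -ltnS.
rewrite -(sum_qbin_qpoch2 q (a * d * q ^+ k) (b * c * q ^+ k) (n - k)).
rewrite !mulr_sumr mulr_suml; apply: eq_bigr => i _.
have le_i : (i <= n - k)%N by rewrite -ltnS.
rewrite /W subnDA (exprNM (a * d)) addKn.
rewrite (qpoch_split q (a * b * q ^+ k) le_i) (qpoch_split q (a * c * q ^+ k) le_i).
rewrite (qpochD q (a * b * c * d * q ^+ n.-1)) exprD /phi !mulrA.
have [->|i_gt0] := posnP i; first by rewrite !qpoch0; ring.
have -> : a * b * c * d * q ^+ n.-1 * q ^+ k =
    a * d * q ^+ k * b * c * q ^+ k * q ^+ (n - k).-1.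
  have n_gt : (k < n)%N by rewrite -subn_gt0; apply: leq_trans le_i.
  have -> : n.-1 = (k + (n - k).-1)%N.
    by rewrite -!subn1 addnBA ?subn_gt0 // subnKC.
  by rewrite exprD; ring.
by ring.
Qed.

End Evaluation.
End Terminating.

(** * Formal power series *)

Section FpsCoefficients.
Variable K : comNzRingType.
Implicit Types f g : fps K.

Lemma coef_fpsM f g n :
  fps_coef (f * g) n = \sum_(i < n.+1) fps_coef f i * fps_coef g (n - i)%N.
Proof. by []. Qed.

Lemma coef_fpsD f g n : fps_coef (f + g) n = fps_coef f n + fps_coef g n.
Proof. by []. Qed.

Lemma coef_fpsN f n : fps_coef (- f) n = - fps_coef f n.
Proof. by []. Qed.

Lemma coef_fps1 n : fps_coef (1 : fps K) n = (n == 0%N)%:R.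
Proof. by rewrite /GRing.one /=; case: eqP. Qed.

Lemma coef_fps_sum I (r : seq I) (P : pred I) (F : I -> fps K) n :
  fps_coef (\sum_(i <- r | P i) F i) n =
  \sum_(i <- r | P i) fps_coef (F i) n.
Proof.
apply: (big_morph (fun f => fps_coef f n)) => //.
by rewrite /GRing.zero /= if_same.
Qed.

Lemma coef_fpsCM (c : K) f n : fps_coef (c%:S * f) n = c * fps_coef f n.
Proof.
rewrite coef_fpsM big_ord_recl /= subn0 big1 ?addr0 // => i _.
by rewrite mul0r.
Qed.

Lemma coef_fpsXM f n :
  fps_coef (fpsX * f) n = if n is m.+1 then fps_coef f m else 0.
Proof.
rewrite coef_fpsM big_ord_recl /= mul0r add0r.
case: n => [|n]; first by rewrite big_ord0.
rewrite big_ord_recl /= mul1r subn1 big1 ?addr0 // => i _.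
by rewrite mul0r.
Qed.

Lemma coef_fpsXnM f k n :
  fps_coef (fpsX ^+ k * f) n = if (k <= n)%N then fps_coef f (n - k) else 0.
Proof.
elim: k n => [|k IHk] n; first by rewrite mul1r subn0.
by rewrite exprS -mulrA coef_fpsXM; case: n => // n; rewrite IHk.
Qed.

Fact fpsC_is_zmod_morphism : zmod_morphism (@fpsC K).
Proof. by move=> x y; apply/fpsP => -[|n] //=; rewrite subr0. Qed.

Fact fpsC_is_monoid_morphism : monoid_morphism (@fpsC K).
Proof.
split=> // x y; apply/fpsP => n; rewrite coef_fpsCM /=.
by case: eqP => // _; rewrite mulr0.
Qed.

HB.instance Definition _ :=
  GRing.isZmodMorphism.Build K (fps K) (@fpsC K) fpsC_is_zmod_morphism.
HB.instance Definition _ :=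
  GRing.isMonoidMorphism.Build K (fps K) (@fpsC K) fpsC_is_monoid_morphism.

(** The substitution of [s t] for [t]. *)
Definition fps_dilate (s : K) f : fps K := Fps (fun n => s ^+ n * fps_coef f n).

Lemma fps_dilateM s f g :
  fps_dilate s (f * g) = fps_dilate s f * fps_dilate s g.
Proof.
apply/fpsP => n; rewrite coef_fpsM /= mulr_sumr; apply: eq_bigr => i _.
have le_in : (i <= n)%N by rewrite -ltnS.
by rewrite -{1}(subnKC le_in) exprD; ring.
Qed.

End FpsCoefficients.

(** * Generating functions *)

Section EulerSeries.
Variables (K : numFieldType) (q : K).
Hypothesis q_neq0 : q != 0.
Hypothesis qfact_neq0 : forall n, qpoch q q n != 0.

Let onemX_neq0 n : 1 - q ^+ n.+1 != 0.
Proof. by have := qfact_neq0 n.+1; rewrite qpochS -exprS mulf_eq0 => /norP[]. Qed.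

(** Euler's expansion of [(ut)_oo] in powers of [t]. *)
Definition euler_series (u : K) : fps K :=
  Fps (fun n => (- u) ^+ n * q ^+ 'C(n, 2) / qpoch q q n).

Lemma euler_series_unit u : euler_series u \is a GRing.unit.
Proof.
by rewrite unfold_in /= /fps_unit /= qpoch0 !mul1r invr1 oner_eq0.
Qed.

Lemma dilate_euler_series s u : fps_dilate s (euler_series u) = euler_series (u * s).
Proof. by apply/fpsP => n /=; rewrite exprNM; ring. Qed.

Lemma euler_seriesS u : euler_series u = (1 - u%:S * fpsX) * euler_series (u * q).
Proof.
apply/fpsP => n; rewrite mulrBl mul1r -mulrA coef_fpsD coef_fpsN coef_fpsCM.
rewrite coef_fpsXM /=; case: n => [|n]; first by rewrite !mul1r mulr0 subr0.
rewrite qpochS -exprS binS bin1 exprD !exprNM !exprS.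
by field; rewrite qfact_neq0 -exprS onemX_neq0.
Qed.

Lemma euler_series_qpoch u k :
  euler_series u = qpoch q%:S (u%:S * fpsX) k * euler_series (u * q ^+ k).
Proof.
elim: k => [|k IHk]; first by rewrite qpoch0 mul1r mulr1.
rewrite IHk (euler_seriesS (u * q ^+ k)) qpochS -(mulrA u) -exprSr.
by rewrite -mulrA rmorphM rmorphXn /= [_ * _ * fpsX]mulrAC.
Qed.

(** The equation determines each coefficient from the previous one because
    [1 - q^(n+1)] is invertible. *)
Lemma euler_series_unique a (f : fps K) : fps_coef f 0 = 1 ->
  f = (1 - a%:S * fpsX) * fps_dilate q f -> f = euler_series a.
Proof.
move=> f0 fE; apply/fpsP; elim=> [|n IHn]; first by rewrite f0 /= qpoch0 !mul1r invr1.
have := congr1 (fun g => fps_coef g n.+1) fE.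
rewrite mulrBl mul1r -mulrA coef_fpsD coef_fpsN coef_fpsCM coef_fpsXM /= => fS.
have {fS} : (1 - q ^+ n.+1) * fps_coef f n.+1 = - a * q ^+ n * fps_coef f n.
  by rewrite mulrBl mul1r {1}fS; ring.
move/(canRL (mulKf (onemX_neq0 n))) ->; rewrite IHn /=.
rewrite qpochS -exprS binS bin1 exprD (exprS (- a)).
by field; rewrite qfact_neq0 onemX_neq0.
Qed.

Section GeneratingFunctions.
Variables (a b c z w : K).
Hypothesis zw1 : z * w = 1.
Let y := z + w.

(** The recurrence says that [h] satisfies
    [(1 - zt) (1 - wt) h(t) = (1 - at) h(qt)]; multiplied by the series of [z] and [w],
    it becomes the equation which characterizes the series of [a]. *)
Lemma big_qhermite_gf :
  euler_series z * euler_series w * Fps (fun n => big_qhermite q a y n / qpoch q q n) =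
  euler_series a.
Proof.
set h := Fps _.
have hE : (1 - z%:S * fpsX) * (1 - w%:S * fpsX) * h =
    (1 - a%:S * fpsX) * fps_dilate q h.
  have -> : (1 - z%:S * fpsX) * (1 - w%:S * fpsX) * h =
      h - y%:S * (fpsX * h) + fpsX * (fpsX * h).
    have zwS : z%:S * w%:S = 1 :> fps K by rewrite -rmorphM zw1 rmorph1.
    have -> : fpsX * (fpsX * h) = z%:S * w%:S * (fpsX * (fpsX * h)).
      by rewrite zwS mul1r.
    by rewrite rmorphD /=; ring.
  apply/fpsP => n; rewrite mulrBl mul1r -mulrA !coef_fpsD !coef_fpsN !coef_fpsCM.
  rewrite !coef_fpsXM; case: n => [|n]; first by rewrite /= qpoch0; ring.
  rewrite coef_fpsXM; case: n => [|n].
    by rewrite /= qpochS qpoch0; field; have := onemX_neq0 0; rewrite expr1.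
  rewrite /= !qpochS -!exprS; field.
  by rewrite qfact_neq0 !onemX_neq0.
apply: euler_series_unique.
  by rewrite !coef_fpsM !big_ord1 /= big_ord1 /= !qpoch0; field.
rewrite !fps_dilateM !dilate_euler_series {1}(euler_seriesS z) {1}(euler_seriesS w).
by rewrite [RHS]mulrCA -hE; ring.
Qed.

Lemma al_salam_chihara_gf :
  euler_series z * euler_series w *
    Fps (fun n => al_salam_chihara q a b y n / qpoch q q n) =
  euler_series a * euler_series b.
Proof.
rewrite -big_qhermite_gf -[RHS]mulrA; congr (_ * _).
apply/fpsP => n; rewrite coef_fpsM /= mulr_suml; apply: eq_bigr => j _.
have le_jn : (j <= n)%N by rewrite -ltnS.
by rewrite qbinE //; field; rewrite !qfact_neq0.
Qed.

Lemma bin2D i j : 'C(i + j, 2) = ('C(i, 2) + 'C(j, 2) + i * j)%N.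
Proof.
elim: j => [|j IHj]; first by rewrite addn0 muln0 !addn0.
by rewrite addnS !binS !bin1 IHj mulnS; lia.
Qed.

(** After the two sums are exchanged, the coefficient of [p_m(a,b)] is
    [(-c)^L q^C(L,2)], with [L = n - m], times the sum [sum_qbin_qpoch] at
    [v = a b q^m]; the powers of [q] match by [bin2D]. *)
Lemma sum_dual_qhahn n :
  \sum_(k < n.+1) qbin q n k * ((- (a * b * c * q ^+ k)) ^+ (n - k)
    * q ^+ 'C(n - k, 2) * dual_qhahn q a b c y k) =
  \sum_(k < n.+1) qbin q n k * ((- c) ^+ (n - k)
    * q ^+ 'C(n - k, 2) * al_salam_chihara q a b y k).
Proof.
pose W k := (- (a * b * c * q ^+ k)) ^+ (n - k) * q ^+ 'C(n - k, 2).
under eq_bigr do rewrite -/(W _) !mulr_sumr.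
rewrite (sum_triangle n (fun k m => qbin q n k * (W k * (qbin q k m *
  ((- c) ^+ (k - m) * q ^+ 'C(k - m, 2) * qpoch q (a * b * q ^+ m) (k - m)
   * al_salam_chihara q a b y m))))).
apply: eq_bigr => m _; rewrite -[RHS]mulr1.
rewrite -[X in _ = _ * X](sum_qbin_qpoch q (a * b * q ^+ m) (n - m)) [RHS]mulr_sumr.
apply: eq_bigr => i _.
have le_mn : (m <= n)%N by rewrite -ltnS.
have le_i : (i <= n - m)%N by rewrite -ltnS.
have le_n : (m + i <= n)%N by rewrite -leq_subRL.
rewrite /W addKn subnDA.
set L := (n - m)%N in le_i *; set T := al_salam_chihara _ _ _ _ _.
transitivity (qbin q n (m + i) * qbin q (m + i) m *
  ((- (a * b * c * q ^+ (m + i))) ^+ (L - i) * q ^+ 'C(L - i, 2) *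
  ((- c) ^+ i * q ^+ 'C(i, 2) * qpoch q (a * b * q ^+ m) i * T))); first by ring.
rewrite qbin_mul // -/L.
have -> : - (a * b * c * q ^+ (m + i)) = (- c) * (a * b * q ^+ m) * q ^+ i.
  by rewrite exprD; ring.
rewrite !exprMn.
have -> : (- c) ^+ L = (- c) ^+ i * (- c) ^+ (L - i).
  by rewrite -exprD subnKC.
have -> : q ^+ 'C(L, 2) = q ^+ 'C(i, 2) * q ^+ 'C(L - i, 2) * (q ^+ i) ^+ (L - i).
  by rewrite -exprM -!exprD -bin2D subnKC.
by ring.
Qed.

Lemma dual_qhahn_coef n :
  fps_coef (\sum_(k < n.+1) (dual_qhahn q a b c y k / qpoch q q k)%:S
    * (fpsX ^+ k * euler_series (a * b * c * q ^+ k))) n =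
  fps_coef (Fps (fun n => al_salam_chihara q a b y n / qpoch q q n) * euler_series c) n.
Proof.
rewrite coef_fps_sum coef_fpsM.
transitivity ((\sum_(k < n.+1) qbin q n k * ((- (a * b * c * q ^+ k)) ^+ (n - k)
    * q ^+ 'C(n - k, 2) * dual_qhahn q a b c y k)) / qpoch q q n).
  rewrite mulr_suml; apply: eq_bigr => k _.
  have le_kn : (k <= n)%N by rewrite -ltnS.
  rewrite coef_fpsCM coef_fpsXnM le_kn qbinE //=.
  by field; rewrite !qfact_neq0.
rewrite sum_dual_qhahn mulr_suml; apply: eq_bigr => k _.
have le_kn : (k <= n)%N by rewrite -ltnS.
by rewrite qbinE //=; field; rewrite !qfact_neq0.
Qed.

End GeneratingFunctions.

(** The finite [q]-binomial theorem, read in the ring of power series. *)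
Lemma coef_qpoch_fps u N n : (n <= N)%N ->
  fps_coef (qpoch q%:S (u%:S * fpsX) N) n =
  qbin q N (N - n) * ((- u) ^+ n * q ^+ 'C(n, 2)).
Proof.
move=> le_nN; rewrite -qbinomial coef_fps_sum.
have coefE (k : nat) : (k <= N)%N ->
    fps_coef (qbin q%:S N k * ((- (u%:S * fpsX)) ^+ (N - k) * q%:S ^+ 'C(N - k, 2))) n
    = (qbin q N k * ((- u) ^+ (N - k) * q ^+ 'C(N - k, 2))) * (n == N - k)%N%:R.
  move=> le_kN; rewrite exprNM -rmorphN -!rmorphXn -rmorph_qbin.
  rewrite [X in fps_coef X _](_ : _ = (qbin q N k * ((- u) ^+ (N - k) *
     q ^+ 'C(N - k, 2)))%:S * (fpsX ^+ (N - k) * 1)); last by rewrite !rmorphM /=; ring.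
  rewrite coef_fpsCM coef_fpsXnM coef_fps1; case: leqP => [le_n|lt_n].
    by rewrite subn_eq0 eqn_leq le_n andbT.
  by rewrite ltn_eqF.
rewrite (bigD1 (inord (N - n) : 'I_N.+1)) // inordK ?ltnS ?leq_subr //.
rewrite coefE ?leq_subr // subKn // eqxx mulr1 big1 => [|k ne_k]; first exact: addr0.
have le_kN : (k <= N)%N by rewrite -ltnS.
rewrite coefE //; case: eqP => [nE|]; last by rewrite mulr0.
by case/eqP: ne_k; apply: val_inj; rewrite /= nE subKn // inordK.
Qed.

Local Open Scope classical_set_scope.

Hypothesis cvg_qn : (fun n => q ^+ n) @ \oo --> (0 : K).

Lemma cvg_qpoch n : (fun N => qpoch q (q * q ^+ N) n) @ \oo --> (1 : K).
Proof.
elim: n => [|n IHn].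
  under eq_fun do rewrite qpoch0; exact: cvg_cst.
under eq_fun do rewrite qpochS.
have cvg1 : (fun N => 1 - q * q ^+ N * q ^+ n) @ \oo --> 1 - q * 0 * q ^+ n.
  apply: cvgB; first exact: cvg_cst.
  by apply: cvgM; [apply: cvgM => //|]; exact: cvg_cst.
have : (fun N => qpoch q (q * q ^+ N) n * (1 - q * q ^+ N * q ^+ n)) @ \oo
    --> 1 * (1 - q * 0 * q ^+ n) by exact: cvgM.
by rewrite mulr0 mul0r subr0 mulr1.
Qed.

(** As [N] grows, the finite [q]-binomial coefficient [(N choose n)] tends to
    [1 / (q)_n]. *)
Lemma qpoch_infty_euler_series u : qpoch_infty q (u%:S * fpsX) = euler_series u.
Proof.
apply/fpsP => n /=; apply: cvg_lim => //; rewrite -(cvg_shiftn n) /=.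
have coefE N : fps_coef (qpoch q%:S (u%:S * fpsX) (N + n)) n =
    (- u) ^+ n * q ^+ 'C(n, 2) / qpoch q q n * qpoch q (q * q ^+ N) n.
  rewrite coef_qpoch_fps ?leq_addl // addnK qbinE ?leq_addr // addKn.
  by rewrite qpochD; field; rewrite !qfact_neq0.
under eq_fun do rewrite coefE.
set e := (_ / _).
have : (fun N => e * qpoch q (q * q ^+ N) n) @ \oo --> e * 1.
  by apply: cvgM; [exact: cvg_cst | exact: cvg_qpoch].
by rewrite mulr1.
Qed.

End EulerSeries.

(** * Series of increasing order *)

Section Series.
Variable K : numFieldType.
Implicit Types (f : fps K) (u : nat -> fps K).

(** The partial sums of each coefficient are eventually constant, so the limit is a
    finite sum; [m] is free because longer sums only add zeros. *)
Lemma coef_fps_series u n m : (forall k l, (l < k)%N -> fps_coef (u k) l = 0) ->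
  (n <= m)%N -> fps_coef (fps_series u) n = \sum_(k < m.+1) fps_coef (u k) n.
Proof.
move=> u0 le_nm.
have coefE N : (n <= N)%N -> \sum_(k < N.+1) fps_coef (u k) n =
    \sum_(k < n.+1) fps_coef (u k) n.
  move/subnKC <-; elim: (N - n)%N => [|j IHj]; first by rewrite addn0.
  by rewrite addnS big_ord_recr /= u0 ?addr0 // ltnS leq_addr.
rewrite coefE //=; apply: norm_lim_near_cst; exists n.+1 => //= -[//|N] /=.
by rewrite coef_fps_sum; exact: coefE.
Qed.

Lemma fps_mul_series f u : (forall k l, (l < k)%N -> fps_coef (u k) l = 0) ->
  f * fps_series u = fps_series (fun k => f * u k).
Proof.
move=> u0; have fu0 k l : (l < k)%N -> fps_coef (f * u k) l = 0.
  move=> lt_lk; rewrite coef_fpsM big1 // => i _.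
  by rewrite u0 ?mulr0 // (leq_ltn_trans (leq_subr _ _)).
apply/fpsP => n; rewrite (coef_fps_series fu0 (leqnn n)) coef_fpsM.
under [RHS]eq_bigr do rewrite coef_fpsM.
rewrite exchange_big; apply: eq_bigr => i _.
by rewrite (coef_fps_series u0 (leq_subr i n)) mulr_sumr.
Qed.

End Series.

(** * Complex parameters *)

Lemma cvg_expr0P (K : numFieldType) (x : K) :
  ((fun n => x ^+ n) @ \oo --> (0 : K))%classic <->
  (forall e, 0 < e -> \forall n \near \oo%classic, `|x ^+ n| < e).
Proof. exact: cvgr0Pnorm_lt. Qed.

Lemma expCN (R : realType) (z : R[i]) : expC z * expC (- z) = 1.
Proof.
case: z => x y; rewrite /expC /= cosN sinN expRN.
apply/eqP; rewrite eq_complex /=; have := cos2Dsin2 y => cs.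
have e0 : expR x != 0 by rewrite gt_eqF ?expR_gt0.
apply/andP; split; apply/eqP; last by field.
by rewrite -[RHS]cs; field.
Qed.

Section ComplexBase.
Variables (R : realType) (q : R[i]).
Hypotheses (q_gt0 : 0 < `|q|) (q_lt1 : `|q| < 1).

Let q_neq0 : q != 0.
Proof. by rewrite -normr_gt0. Qed.

Lemma qfact_neq0_of_lt1 n : qpoch q q n != 0.
Proof.
rewrite prodf_seq_neq0; apply/allP => i _ /=; rewrite -exprS subr_eq0.
apply/eqP => /(congr1 Num.norm); rewrite normr1 normrX => q1.
have : `|q| ^+ i.+1 < 1 by rewrite exprn_ilt1.
by rewrite -q1 ltxx.
Qed.

(** The absolute value of a complex number is itself a complex number with zero
    imaginary part; the proof transports the real geometric sequence along that
    embedding. *)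
Lemma cvg_expr_lt1 : ((fun n => q ^+ n) @ \oo --> (0 : (R[i] : numFieldType)))%classic.
Proof.
apply/cvg_expr0P => e e_gt0.
pose r := complex.Re `|q|; pose s := complex.Re e.
have qE : `|q| = r%:C%C by rewrite RRe_real // ger0_real.
have eE : e = s%:C%C by rewrite RRe_real // ger0_real // ltW.
have r_lt1 : `|r| < 1.
  have: 0 <= r by rewrite -ler0c -qE normr_ge0.
  by move/ger0_norm ->; rewrite -ltcR -qE.
have s_gt0 : 0 < s by rewrite -ltcR -eE.
have := cvg_expr r_lt1 => /cvg_expr0P /(_ s s_gt0).
apply: filterS => n /=.
have r_ge0 : 0 <= r by rewrite -ler0c -qE normr_ge0.
rewrite ger0_norm ?exprn_ge0 // => lt_rs.
by rewrite normrX qE eE -rmorphXn /= ltcR.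
Qed.

Lemma askey_wilson_sumE n a b c d theta : a != 0 ->
  qpochs q [:: a * b; a * c; a * d] n != 0 ->
  askey_wilson_sum q n a b c d theta =
  aw_poly q a b c d (expC ('i%C * theta) + expC (- ('i%C * theta))) n.
Proof.
move=> a0; rewrite /qpochs !big_cons big_nil mulr1 !mulf_eq0 => nz0.
have /norP[ab0 /norP[ac0 ad0]] := nz0; rewrite /askey_wilson_sum.
apply: (mulfI (expf_neq0 n a0)).
rewrite (aw_poly_sum q_neq0 qfact_neq0_of_lt1 _ _ _ _ (expCN _)).
rewrite mulrCA mulrA divfK ?expf_neq0 // mulr_sumr; apply: eq_bigr => k _.
have le_kn : (k <= n)%N by rewrite -ltnS.
rewrite /qpochs !big_cons !big_nil !mulr1 (aw_coefE q_neq0 qfact_neq0_of_lt1 le_kn).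
move: ab0 ac0 ad0; rewrite !(fun x => qpoch_split q x le_kn).
rewrite !mulf_eq0 => /norP[ab1 ab2] /norP[ac1 ac2] /norP[ad1 ad2].
have -> : qpoch q (a * b * c * d * (q ^+ n / q)) k =
    qpoch q (a * b * c * d * q ^+ n.-1) k.
  have [->|k_gt0] := posnP k; first by rewrite !qpoch0.
  have qpred m : (0 < m)%N -> q ^+ m / q = q ^+ m.-1.
    by case: m => // m _; rewrite exprSr mulfK.
  by rewrite qpred // (leq_trans k_gt0).
move: (qfact_neq0_of_lt1 k) ab1 ac1 ad1; set q1 := qpoch q q k.
move: q1 (qpoch q (a * b) k) (qpoch q (a * c) k) (qpoch q (a * d) k).
move=> q1 b1 c1 d1 q1_neq0 b1_neq0 c1_neq0 d1_neq0.
move: (qpoch _ _ _) (qpoch _ _ _) (qpoch _ _ _) => x1 x2 x3.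
move: (qpoch _ _ _) (qpoch _ _ _) (qpoch _ _ _) (qpoch _ _ _) (q ^+ k) => x4 x5 x6 x7 x8.
by field; rewrite q1_neq0 b1_neq0 c1_neq0 d1_neq0.
Qed.

End ComplexBase.

(** * The Askey-Wilson family *)

Lemma poly_eq0_of_horner (F : numFieldType) (p : {poly F}) :
  (forall x, p.[x] = 0) -> p = 0.
Proof.
move=> p0; pose rs : seq F := [seq i%:R | i <- iota 0 (size p)].
apply: (@roots_geq_poly_eq0 _ _ rs).
- by apply/allP => x _; rewrite /root p0.
- by rewrite map_inj_uniq ?iota_uniq // => i j /eqP; rewrite eqr_nat => /eqP.
- by rewrite size_map size_iota.
Qed.

Section Family.
Variables (R : realType) (q : R[i]).
Hypotheses (q_gt0 : 0 < `|q|) (q_lt1 : `|q| < 1).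
Local Notation C := R[i].

(** The division-free construction at indeterminate parameters; ['X *+ 2] is the
    value of [z + w] for [x = 'X]. *)
Definition aw_generic n : aw_family R :=
  let X i : {poly mpoly 4 C} := (mpolyX C (mnm1 (inord i)))%:P in
  aw_poly (mpolyC 4 q)%:P (X 0%N) (X 1%N) (X 2) (X 3) ('X *+ 2) n.

Lemma aw_generic_eval n a b c d x :
  (aw_eval (aw_generic n) a b c d).[x] = aw_poly q a b c d (x *+ 2) n.
Proof.
rewrite /aw_eval /aw_generic rmorph_aw_poly.
rewrite -[LHS]/(horner_eval x _) rmorph_aw_poly /=.
rewrite !map_polyC /= !mevalXU mevalC /horner_eval !hornerC.
by rewrite rmorphMn /= map_polyX hornerMn hornerX !(tnth_nth 0) /= !inordK.
Qed.

Lemma aw_generic_family n : is_askey_wilson q n (aw_generic n).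
Proof.
move=> a b c d theta a0 abcd0; rewrite aw_generic_eval.
rewrite -mulr_natr /cosC divfK ?pnatr_eq0 //.
by symmetry; apply: askey_wilson_sumE.
Qed.

Lemma askey_wilson_familyP n : is_askey_wilson q n (askey_wilson_family q n).
Proof. by apply: xgetPex; exists (aw_generic n); exact: aw_generic_family. Qed.

Lemma mmap_polyC_horner (v : 'I_4 -> {poly C}) (a : C) (p : mpoly 4 C) :
  (mmap (@polyC C) v p).[a] = meval (fun i => (v i).[a]) p.
Proof.
rewrite mevalE /mmap horner_sum; apply: eq_bigr => m _.
rewrite hornerM hornerC /mmap1 horner_prod; congr (_ * _).
by apply: eq_bigr => i _; rewrite horner_exp.
Qed.

(** At the non-exceptional nonzero [a] both sides are the Askey-Wilson sum.  As
    polynomials [Q1], [Q2] in an indeterminate [a] they satisfy [(Q1 - Q2) D = 0] for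
    the nonzero polynomial [D] that vanishes at the other values of [a], so they
    coincide and the equality extends to all [a]. *)
Lemma askey_wilson_horner n a b c theta :
  (askey_wilson q n a b c 0).[cosC theta] =
  aw_poly q a b c 0 (expC ('i%C * theta) + expC (- ('i%C * theta))) n.
Proof.
set x := cosC theta; set y := _ + _.
pose v := tnth [tuple 'X; b%:P; c%:P; 0 : {poly C}].
pose Q1 := (map_poly (mmap (@polyC C) v) (askey_wilson_family q n)).[x%:P].
pose Q2 := aw_poly q%:P 'X b%:P c%:P 0 y%:P n.
have Q1E t : Q1.[t] = (askey_wilson q n t b c 0).[x].
  rewrite /Q1 -[LHS]/(horner_eval t _) -horner_map -map_poly_comp.
  rewrite /= /horner_eval hornerC /askey_wilson /aw_eval; congr (_.[x]).
  apply: eq_map_poly => p /=; rewrite mmap_polyC_horner; apply: meval_eq => i.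
  rewrite /v !(tnth_nth 0); 
  by case: i => -[|[|[|[|i]]]] lt_i //=; rewrite ?hornerX ?hornerC.
have Q2E t : Q2.[t] = aw_poly q t b c 0 y n.
  rewrite /Q2 -[LHS]/(horner_eval t _) rmorph_aw_poly /= /horner_eval.
  by rewrite !hornerC hornerX.
pose D := 'X * qpochs q%:P [:: 'X * b%:P; 'X * c%:P; 0] n.
have DE t : D.[t] = t * qpochs q [:: t * b; t * c; t * 0] n.
  rewrite /D /qpochs !big_cons !big_nil !mulr1 !hornerM hornerX.
  rewrite -!/(horner_eval t _) !rmorph_qpoch /= /horner_eval.
  by rewrite !hornerM !hornerC hornerX mulr0.
have D_neq0 : D != 0.
  rewrite mulf_neq0 ?polyX_eq0 //; apply/eqP => /(congr1 (horner_eval 0)).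
  rewrite /qpochs !big_cons !big_nil !mulr1 !rmorphM !rmorph_qpoch /=.
  rewrite /horner_eval !hornerM hornerX !mul0r !horner0 !qpoch_zero !mul1r.
  by apply/eqP; rewrite oner_eq0.
suff Q12 : Q1 = Q2 by rewrite -Q1E Q12 Q2E.
apply/eqP; rewrite -subr_eq0 -(mulIr_eq0 _ (mulIf D_neq0)); apply/eqP.
apply: poly_eq0_of_horner => t; rewrite hornerM hornerD hornerN Q1E Q2E DE.
have [->|t_neq0] := eqVneq t 0; first by rewrite mul0r mulr0.
have [->|nz] := eqVneq (qpochs q [:: t * b; t * c; t * 0] n) 0.
  by rewrite !mulr0.
rewrite /askey_wilson askey_wilson_familyP //.
by rewrite (askey_wilson_sumE q_gt0 q_lt1) // subrr mul0r.
Qed.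

End Family.

(** * The generating function *)

Lemma divr_cancel (T : comUnitRingType) (x y f g h : T) :
  x \is a GRing.unit -> y \is a GRing.unit ->
  y * f * (g / (x * y) * h) = g / x * (h * f).
Proof.
move=> ux uy; rewrite invrM // -[RHS]mul1r -(divrr uy); ring.
Qed.

Theorem theorem2p9 (R : realType) (q a b c theta : R[i])
    (hq0 : 0 < `|q|) (hq1 : `|q| < 1) :
  let t : fps R[i] := fpsX in
  let x := cosC theta in
  qpochs_infty q [:: (a * b * c)%:S * t] *
    fps_series (fun k =>
      (askey_wilson q k a b c 0).[x]%:S
        / qpochs q%:S [:: q%:S; (a * b * c)%:S * t] k * t ^+ k)
  = qpochs_infty q [:: a%:S * t; b%:S * t; c%:S * t]
    / qpochs_infty q [:: t * (expC ('i%C * theta))%:S;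
                         t * (expC (- ('i%C * theta)))%:S].
Proof.
move=> t x; set z := expC _; set w := expC _.
have zw1 : z * w = 1 by exact: expCN.
have polyE k : (askey_wilson q k a b c 0).[x] = dual_qhahn q a b c (z + w) k.
  by rewrite /x (askey_wilson_horner hq0 hq1) aw_poly0.
clearbody x z w.
have q_neq0 : q != 0 by rewrite -normr_gt0.
have qf := qfact_neq0_of_lt1 hq1.
have unitq k : qpoch q q k \is a GRing.unit by rewrite unitfE.
have unitqS k : qpoch q%:S q%:S k \is a @GRing.unit (fps R[i]).
  by rewrite -rmorph_qpoch; exact: rmorph_unit.
have unitQ k : qpoch q%:S ((a * b * c)%:S * t) k \is a GRing.unit.
  have := euler_series_unit q (a * b * c).
  by rewrite (euler_series_qpoch qf (a * b * c) k) unitrM => /andP[].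
have inftyE u : qpoch_infty q (u%:S * t) = euler_series q u.
  exact: (qpoch_infty_euler_series qf (cvg_expr_lt1 hq1)).
have inftyE1 u : qpochs_infty q [:: u%:S * t] = euler_series q u.
  by rewrite /qpochs_infty big_seq1 inftyE.
have inftyE2 u v : qpochs_infty q [:: t * u%:S; t * v%:S] =
    euler_series q u * euler_series q v.
  by rewrite /qpochs_infty big_cons big_seq1 ![t * _]mulrC !inftyE.
have inftyE3 : qpochs_infty q [:: a%:S * t; b%:S * t; c%:S * t] =
    euler_series q a * (euler_series q b * euler_series q c).
  by rewrite /qpochs_infty 2!big_cons big_seq1 !inftyE.
rewrite inftyE1 inftyE2 inftyE3.
rewrite fps_mul_series => [|k l lt_lk]; last first.
  by rewrite mulrC coef_fpsXnM leqNgt lt_lk.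
have termE k : euler_series q (a * b * c) * ((askey_wilson q k a b c 0).[x]%:S
      / qpochs q%:S [:: q%:S; (a * b * c)%:S * t] k * t ^+ k) =
    (dual_qhahn q a b c (z + w) k / qpoch q q k)%:S
      * (t ^+ k * euler_series q (a * b * c * q ^+ k)).
  rewrite polyE /qpochs big_cons big_seq1.
  rewrite (rmorphM _ (dual_qhahn _ _ _ _ _ _)) (rmorphV _ (unitq k)) /=.
  rewrite rmorph_qpoch /= (euler_series_qpoch qf (a * b * c) k).
  by apply: divr_cancel; [exact: unitqS | exact: unitQ].
under [in LHS]eq_fun do rewrite termE.
set G := Fps (fun n => al_salam_chihara q a b (z + w) n / qpoch q q n).
have -> : fps_series (fun k => (dual_qhahn q a b c (z + w) k / qpoch q q k)%:S
      * (t ^+ k * euler_series q (a * b * c * q ^+ k))) = G * euler_series q c.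
  apply/fpsP => n; rewrite -(dual_qhahn_coef q_neq0 qf).
  rewrite (@coef_fps_series _ _ n n) ?coef_fps_sum // => k l lt_lk.
  by rewrite coef_fpsCM coef_fpsXnM leqNgt lt_lk mulr0.
rewrite (mulrA (euler_series q a)) -(al_salam_chihara_gf qf a b zw1) -/G.
rewrite -(mulrA (euler_series q z * euler_series q w)) [RHS]mulrC mulKr //.
by rewrite unitrM !euler_series_unit.
Qed.
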